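(* Let $X,Y$ be Banach spaces, $A\in\mathcal{L}(X)$, $B\in\mathcal{L}(Y,X)$, $C\in\mathcal{L}(X,Y)$, $D\in\mathcal{L}(Y)$, and let $M=\begin{pmatrix}A&B\\ C&D\end{pmatrix}$, a bounded linear operator on $X\oplus Y$. Suppose that $A$ and $D$ have group inverses. If $CA^{\pi}=0$, $BD^{\pi}=0$, $A^{\pi}BC=0$, $BCA=0$ and $DC=CA^{\#}BC$, then $M$ has a group inverse.
   Context: $\mathcal{L}(X,Y)$ denotes the bounded linear operators from $X$ to $Y$, and $\mathcal{L}(X)=\mathcal{L}(X,X)$. In a ring $R$ with identity, $a\in R$ has a group inverse if there is $x\in R$ with $x=xax$, $ax=xa$ and $a=a^2x$; such $x$ is unique if it exists and is denoted $a^{\#}$, and then $a^{\pi}=1-aa^{\#}$. These notions are applied in the rings $\mathcal{L}(X)$, $\mathcal{L}(Y)$ and $\mathcal{L}(X\oplus Y)$. *)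

(* Defs.v *)
From HB Require Import structures.
From mathcomp Require Import all_boot all_order all_algebra.
From mathcomp Require Import all_classical all_reals all_analysis.

Set Implicit Arguments.
Unset Strict Implicit.
Unset Printing Implicit Defensive.

Import Order.TTheory GRing.Theory Num.Theory.
Import numFieldNormedType.Exports.

Local Open Scope classical_set_scope.
Local Open Scope ring_scope.

(* Over a pzRingType, since L(X) is the trivial ring when X = 0. *)
Section GroupInverse.
Variable R : pzRingType.
Implicit Types a x y : R.

Definition is_group_inverse a x : Prop :=
  [/\ x = x * a * x, a * x = x * a & a = a ^+ 2 * x].

Definition has_group_inverse a : Prop := exists x, is_group_inverse a x.

Lemma is_group_inverse_uniq a x y :
  is_group_inverse a x -> is_group_inverse a y -> x = y.
Proof.
move=> [xax axC aax] [yay ayC aay].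
have axy : a * x = a * y.
  have axa : x * a * a = a by rewrite -axC -mulrA -axC mulrA -expr2 -aax.
  have aya : a * (a * y) = a by rewrite mulrA -expr2 -aay.
  by rewrite axC -{1}aya !mulrA axa.
by rewrite xax -mulrA axy mulrA -axC axy ayC -yay.
Qed.

(* a^#, with junk value 0 when a has no group inverse *)
Definition group_inverse a : R := xget 0 [set x | is_group_inverse a x].

Lemma group_inverseP a :
  has_group_inverse a -> is_group_inverse a (group_inverse a).
Proof. by move=> [x ax]; rewrite /group_inverse; case: xgetP => // /(_ x). Qed.

(* a^pi *)
Definition spectral_idempotent a : R := 1 - a * group_inverse a.

End GroupInverse.

Definition bounded_operator (K : numFieldType) (X Y : normedModType K)
    (f : X -> Y) : Prop :=
  exists M : K, forall x, `|f x| <= M * `|x|.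

Definition is_bounded_linear (K : numFieldType) (X Y : normedModType K) :
    {pred X -> Y} :=
  fun f => `[< linear f /\ bounded_operator f >].

Section BoundedLinear.
Variable K : numFieldType.
Implicit Types X Y Z : normedModType K.

Lemma bounded_operator_ge0 X Y (f : X -> Y) : linear f ->
  bounded_operator f -> exists2 M : K, 0 <= M & forall x, `|f x| <= M * `|x|.
Proof.
move=> lf [M fM]; have [[x x0]|X0] := pselect (exists x : X, x != 0).
  exists M => //; rewrite -(@pmulr_lge0 _ `|x|) ?normr_gt0//.
  exact: le_trans (normr_ge0 _) (fM x).
exists 0 => // x; rewrite mul0r; have -> : x = 0.
  by apply/eqP; apply: contrapT => /negP x0; apply: X0; exists x.
have /= := lf (-1) 0 0; rewrite scaler0 addr0 scaleN1r addNr => ->.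
by rewrite normr0.
Qed.

Lemma is_bounded_linear_submod X Y : submod_closed (@is_bounded_linear K X Y).
Proof.
split.
  have E x : (0 : X -> Y) x = 0 by [].
  apply/asboolP; split; first by move=> a x y; rewrite !E scaler0 addr0.
  by exists 0 => x; rewrite E normr0 mul0r.
move=> a f g /asboolP[lf bf] /asboolP[lg bg].
have E x : (a *: f + g) x = a *: f x + g x by [].
apply/asboolP; split.
  move=> b x y; rewrite !E lf lg !scalerDr !scalerA (mulrC b a).
  by rewrite -!addrA; congr (_ + _); rewrite addrCA.
have [M M0 fM] := bounded_operator_ge0 lf bf.
have [N N0 gN] := bounded_operator_ge0 lg bg.
exists (`|a| * M + N) => x; rewrite E mulrDl.
apply: le_trans (ler_normD _ _) _; apply: lerD => //.
by rewrite normrZ -mulrA ler_wpM2l.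
Qed.

HB.instance Definition _ X Y :=
  GRing.isSubmodClosed.Build K (X -> Y) (@is_bounded_linear K X Y)
    (is_bounded_linear_submod X Y).

End BoundedLinear.

(* L(X, Y), with the pointwise vector space structure *)
Record bounded_linear (K : numFieldType) (X Y : normedModType K) :=
  BoundedLinear {
    bounded_linear_fun :> X -> Y;
    bounded_linearP : bounded_linear_fun \in @is_bounded_linear K X Y }.

Section BoundedLinearTheory.
Variable K : numFieldType.
Implicit Types X Y Z : normedModType K.

HB.instance Definition _ X Y :=
  [isSub for @bounded_linear_fun K X Y].
HB.instance Definition _ X Y :=
  [Choice of bounded_linear X Y by <:].
HB.instance Definition _ X Y :=
  [SubChoice_isSubLmodule of bounded_linear X Y by <:].

Lemma bounded_linear_linear X Y (f : bounded_linear X Y) : linear f.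
Proof. by have /asboolP[] := bounded_linearP f. Qed.

HB.instance Definition _ X Y (f : bounded_linear X Y) :=
  GRing.isLinear.Build K X Y *:%R (bounded_linear_fun f)
    (bounded_linear_linear f).

Lemma bounded_linear_bounded X Y (f : bounded_linear X Y) :
  exists2 M : K, 0 <= M & forall x, `|f x| <= M * `|x|.
Proof.
by apply: bounded_operator_ge0; have /asboolP[] := bounded_linearP f.
Qed.

Lemma bounded_linear_continuous X Y (f : bounded_linear X Y) :
  continuous (f : X -> Y).
Proof.
apply/linear_bounded_continuous/linear_boundedP.
have [M M0 fM] := bounded_linear_bounded f.
near=> r => x; apply: le_trans (fM x) _; apply: ler_wpM2r => //.
by near: r; apply: nbhs_pinfty_ge; rewrite ger0_real.
Unshelve. all: by end_near. Qed.

Lemma bounded_linear_ext X Y (f g : bounded_linear X Y) :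
  (forall x, f x = g x) -> f = g.
Proof. by move=> fg; apply/val_inj/funext. Qed.

Lemma bounded_linear_id_subproof X : (@id X) \in @is_bounded_linear K X X.
Proof. by apply/asboolP; split => //; exists 1 => x; rewrite mul1r. Qed.

Definition bounded_linear_id X : bounded_linear X X :=
  BoundedLinear (bounded_linear_id_subproof X).

Lemma bounded_linear_comp_subproof X Y Z
    (f : bounded_linear Y Z) (g : bounded_linear X Y) :
  (f \o g) \in @is_bounded_linear K X Z.
Proof.
apply/asboolP; split; first by move=> a x y; rewrite /= !linearP.
have [M M0 fM] := bounded_linear_bounded f.
have [N N0 gN] := bounded_linear_bounded g.
exists (M * N) => x /=; apply: le_trans (fM _) _.
by rewrite -mulrA ler_wpM2l.
Qed.

Definition bounded_linear_comp X Y Z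
    (f : bounded_linear Y Z) (g : bounded_linear X Y) : bounded_linear X Z :=
  BoundedLinear (bounded_linear_comp_subproof f g).

Section Ring.
Variable X : normedModType K.
Local Notation comp := (@bounded_linear_comp X X X).

Let compA : associative comp.
Proof. by move=> f g h; apply: bounded_linear_ext. Qed.
Let comp1f : left_id (bounded_linear_id X) comp.
Proof. by move=> f; apply: bounded_linear_ext. Qed.
Let compf1 : right_id (bounded_linear_id X) comp.
Proof. by move=> f; apply: bounded_linear_ext. Qed.
Let compDl : left_distributive comp +%R.
Proof. by move=> f g h; apply: bounded_linear_ext. Qed.
Let compDr : right_distributive comp +%R.
Proof. by move=> f g h; apply: bounded_linear_ext => x; exact: linearD. Qed.

HB.instance Definition _ :=
  GRing.Zmodule_isPzRing.Build (bounded_linear X X)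
    compA comp1f compf1 compDl compDr.

End Ring.

(* The direct sum of X and Y is X * Y with the max norm, which is equivalent  *)
(* to the other usual norms on it and so has the same bounded operators.      *)
Section Block.
Variables X Y : normedModType K.
Variables (A : bounded_linear X X) (B : bounded_linear Y X).
Variables (C : bounded_linear X Y) (D : bounded_linear Y Y).

Definition block_fun (z : X * Y) : X * Y :=
  (A z.1 + B z.2, C z.1 + D z.2).

Lemma block_operator_subproof :
  block_fun \in @is_bounded_linear K (X * Y)%type (X * Y)%type.
Proof.
apply/asboolP; split.
  move=> a [x1 y1] [x2 y2]; rewrite /block_fun /=.
  rewrite !linearP /=; congr (_, _); rewrite /= scalerDr -!addrA;
  by congr (_ + _); rewrite addrCA.
have [MA MA0 AM] := bounded_linear_bounded A.
have [MB MB0 BM] := bounded_linear_bounded B.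
have [MC MC0 CM] := bounded_linear_bounded C.
have [MD MD0 DM] := bounded_linear_bounded D.
exists ((MA + MB) + (MC + MD)) => z.
have z1 : `|z.1| <= `|z| by rewrite prod_normE num_le_max ?lexx// real_comparable.
have z2 : `|z.2| <= `|z|.
  by rewrite prod_normE num_le_max ?lexx ?orbT// real_comparable.
have bnd (U V W : normedModType K) (f : bounded_linear U W)
    (g : bounded_linear V W) (M N : K) u v : 0 <= M -> 0 <= N ->
    (forall x, `|f x| <= M * `|x|) -> (forall x, `|g x| <= N * `|x|) ->
    `|u| <= `|z| -> `|v| <= `|z| -> `|f u + g v| <= (M + N) * `|z|.
  move=> M0 N0 fM gN uz vz; apply: le_trans (ler_normD _ _) _.
  rewrite mulrDl lerD//.
    by apply: le_trans (fM _) _; rewrite ler_wpM2l.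
  by apply: le_trans (gN _) _; rewrite ler_wpM2l.
rewrite [X in X <= _]prod_normE num_ge_max ?real_comparable// /block_fun /=.
apply/andP; split.
  apply: le_trans (bnd _ _ _ _ _ _ _ _ _ MA0 MB0 AM BM z1 z2) _.
  by rewrite ler_wpM2r// lerDl addr_ge0.
apply: le_trans (bnd _ _ _ _ _ _ _ _ _ MC0 MD0 CM DM z1 z2) _.
by rewrite ler_wpM2r// lerDr addr_ge0.
Qed.

Definition block_operator : bounded_linear (X * Y)%type (X * Y)%type :=
  BoundedLinear block_operator_subproof.

End Block.

End BoundedLinearTheory.

Notation "f \oL g" := (bounded_linear_comp f g)
  (at level 50, left associativity, format "f  \oL  g") : ring_scope.

(* Main.v *)
(* Since [C = C A A^#], the hypothesis [B C A = 0] already forces [B C = 0], and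
   then [D C = C A^# B C = 0].  Put [N = C A^# B] and [S = (1, 0; C A^#, 1)].
   Then [S^-1 M S = (A, B; 0, D - N)], where [D - N = U D U^-1] with
   [U = 1 - N D^#], so [D - N] has a group inverse and
   [B (D - N)^pi = B D^pi U^-1 = 0].  The group inverse of this triangular
   operator is classical, and conjugating it back by [S] gives
     M^# = ( A^#       A^pi B D^#^2 - A^# B D^#
             C A^#^2   D^# - C A^# B D^#^2 - C A^#^2 B D^# ). *)
Require Import Defs.
From mathcomp Require Import all_boot all_order all_algebra.
From mathcomp Require Import all_classical all_reals all_analysis.

Import GRing.Theory.

Local Open Scope ring_scope.

Section GroupInverseOperator.
Set Implicit Arguments.
Variables (K : numFieldType) (X : normedModType K) (A : bounded_linear X X).
Hypothesis hA : has_group_inverse A.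
Local Notation G := (group_inverse A).
Local Notation P := (spectral_idempotent A).

(** This and the next few lemmas turn ring identities into rewrite rules on vectors, the form used
    in the block computation. *)
Lemma group_inverse_comm x : A (G x) = G (A x).
Proof.
have [_ AG _] := group_inverseP hA.
exact: (congr1 (fun f : bounded_linear X X => f x) AG).
Qed.

Lemma group_inverse_inner x : G (A (A x)) = A x.
Proof.
have [_ _ AAG] := group_inverseP hA; rewrite -!group_inverse_comm.
exact/esym/(congr1 (fun f : bounded_linear X X => f x) AAG).
Qed.

Lemma group_inverse_outer x : G (G (A x)) = G x.
Proof.
have [GAG _ _] := group_inverseP hA; rewrite -group_inverse_comm.
exact/esym/(congr1 (fun f : bounded_linear X X => f x) GAG).
Qed.

Lemma spectral_idempotentE x : P x = x - G (A x).
Proof. by rewrite -group_inverse_comm. Qed.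

Lemma mul_spectral_idempotent x : A (P x) = 0.
Proof.
by rewrite spectral_idempotentE linearB /= group_inverse_comm
  group_inverse_inner subrr.
Qed.

Lemma group_inverse_spectral_idempotent x : G (P x) = 0.
Proof.
by rewrite spectral_idempotentE linearB /= group_inverse_outer subrr.
Qed.

(** As [P = 1 - G A], vanishing on its range means absorbing [G A]. Used for [C] with [A] and for
    [B] with [D]. *)
Lemma comp_spectral_idempotent_eq0 (Y : normedModType K)
  (C : bounded_linear X Y) : C \oL P = 0 -> forall x, C (G (A x)) = C x.
Proof.
move=> CP x; apply/esym/eqP; rewrite -subr_eq0 -linearB /=.
rewrite -spectral_idempotentE.
exact/eqP/(congr1 (fun f : bounded_linear X Y => f x) CP).
Qed.

End GroupInverseOperator.

Theorem theorem4p7 (K : numFieldType) (X Y : completeNormedModType K)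
  (A : bounded_linear X X) (B : bounded_linear Y X)
  (C : bounded_linear X Y) (D : bounded_linear Y Y)
  (hA : has_group_inverse A) (hD : has_group_inverse D)
  (hCA : C \oL spectral_idempotent A = 0)
  (hBD : B \oL spectral_idempotent D = 0)
  (hABC : spectral_idempotent A \oL B \oL C = 0)
  (hBCA : B \oL C \oL A = 0)
  (hDC : D \oL C = C \oL group_inverse A \oL B \oL C) :
  has_group_inverse (block_operator A B C D).
Proof.
have CGA := comp_spectral_idempotent_eq0 hA hCA.
have BHD := comp_spectral_idempotent_eq0 hD hBD.
have BC x : B (C x) = 0.
  rewrite -CGA -(group_inverse_comm hA).
  exact: (congr1 (fun f : bounded_linear X X => f _) hBCA).
have DC x : D (C x) = 0.
  have /= -> := congr1 (fun f : bounded_linear X Y => f x) hDC.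
  by rewrite BC !linear0.
set G : bounded_linear X X := group_inverse A in CGA *.
set H : bounded_linear Y Y := group_inverse D in BHD *.
pose P : bounded_linear X X := spectral_idempotent A.
(* [H] inherits this from [D C = 0] through [H = H H D]. *)
have HC x : H (C x) = 0 by rewrite -(group_inverse_outer hD) DC !linear0.
have AG := group_inverse_comm hA; have DH := group_inverse_comm hD.
have GAA := group_inverse_inner hA; have HDD := group_inverse_inner hD.
have GGA := group_inverse_outer hA; have HHD := group_inverse_outer hD.
have AP := mul_spectral_idempotent hA.
have GP := group_inverse_spectral_idempotent hA.
have CP x : C (P x) = 0 by rewrite -CGA AP !linear0.
have PE := spectral_idempotentE hA.
rewrite -/G -/H -/P in AG DH GAA HDD GGA HHD AP GP PE.
clearbody G H P.
(* With [E = D - N], the classical corner entry is A^pi B E^#^2 + A^#^2 B E^pi - A^# B E^#. Here B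
   E^pi = 0 and B E^# = B D^#. *)
pose Z := (P \oL B \oL H \oL H) - (G \oL B \oL H).
pose W := block_operator G Z (C \oL G \oL G)
  (H - (C \oL G \oL B \oL H \oL H) - (C \oL G \oL G \oL B \oL H)).
have ZE y : Z y = P (B (H (H y))) - G (B (H y)) by [].
clearbody Z.
have ZC x : Z (C x) = 0 by rewrite ZE HC !linear0 addr0.
have AZ y : A (Z y) = - G (A (B (H y))).
  by rewrite ZE linearB /= AP sub0r AG.
have CZ y : C (Z y) = - C (G (B (H y))).
  by rewrite ZE linearB /= CP sub0r.
have ZD y : G (B y) + Z (D y) = P (B (H y)).
  by rewrite ZE HHD BHD addrC subrK.
have ZHD y : Z (H (D y)) = Z y by rewrite !ZE HHD.
(* [Q] is the candidate for M M^#: the group inverse axioms follow from M W = Q = W M, M Q = M and W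
   Q = W. *)
pose Q := block_operator (G \oL A) (P \oL B \oL H) (C \oL G)
  ((H \oL D) - (C \oL G \oL B \oL H)).
have QE z : Q z = (G (A z.1) + P (B (H z.2)),
                   C (G z.1) + (H (D z.2) - C (G (B (H z.2))))) by [].
have ME z : block_operator A B C D z = (A z.1 + B z.2, C z.1 + D z.2) by [].
have WE z : W z = (G z.1 + Z z.2, C (G (G z.1)) +
  (H z.2 - C (G (B (H (H z.2)))) - C (G (G (B (H z.2)))))) by [].
have MW z : block_operator A B C D (W z) = Q z.
  rewrite ME WE QE /=.
  rewrite !(linearD, linearN) /= !BC !DC AZ CZ AG DH !oppr0 !addr0 !add0r.
  (* In the upper row, [B H - G A B H] folds into [P B H]. *)
  by congr (_, _); [rewrite addrAC -addrA -PE | rewrite addrAC -addrA].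
have WM z : W (block_operator A B C D z) = Q z.
  rewrite ME WE QE /=.
  rewrite !(linearD, linearN) /= ZC HC !linear0 !add0r.
  rewrite HHD BHD GGA -(addrA (G _)) ZD.
  (* In the lower row, the two [C G G B] terms cancel. *)
  by rewrite -addrA [C _ + (_ - _)]addrC subrK.
have MQ z : block_operator A B C D (Q z) = block_operator A B C D z.
  rewrite !ME QE /=.
  rewrite !(linearD, linearN) /= !BC !DC AG GAA AP BHD CGA CP DH HDD.
  by rewrite !oppr0 !(addr0, add0r).
have WQ z : W (Q z) = W z.
  rewrite !WE QE /=.
  rewrite !(linearD, linearN) /= !ZC !HC !linear0 GGA GP !linear0 HHD.
  by rewrite !(addr0, add0r) ZHD.
exists W; split; apply: bounded_linear_ext => z.
- by rewrite -[LHS]WQ -MW.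
- by rewrite [LHS]MW [RHS]WM.
- by rewrite -[LHS]MQ -MW.
Qed.
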